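(* Let the set $Q$ be closed, let the functions $f$ and $\|\varphi(\cdot)\|$ be lower semicontinuous on $Q$, and let $\tau_1 \in \mathcal{T} \cap K^*_{++}$. Suppose also that the penalty function $\Phi_{\tau}$ is locally exact at every globally optimal solution of the problem $(\mathcal{P})$. Consider the Simplest Global Exact Penalty Method described in the context started from $\tau_1$ (with any $\theta>1$), where each penalized problem encountered is assumed to have a globally optimal solution. Then the method either terminates after a finite number of iterations by finding a globally optimal solution of $(\mathcal{P})$ (i.e. the last computed point $x_n$ is such a solution), or generates an infinite sequence $\{x_n\}$ that has no limit points.
   Context: Setting. $(X,d)$ is a metric space, $M, Q \subseteq X$ satisfy $M \cap Q \neq \emptyset$, and $f \colon X \to \mathbb{R} \cup \{+\infty\}$. Problem $(\mathcal{P})$: minimize $f(x)$ subject to $x \in M \cap Q$. It is assumed that $(\mathcal{P})$ has a globally optimal solution and that its optimal value $f_*$ is finite. $Y$ is a real normed space, $K \subset Y$ is a closed convex pointed cone ($K \cap (-K) = \{0\}$). An improper element $\infty$ is added to $Y$, with $\|\infty\| = +\infty$. $\varphi \colon X \to K \cup \{\infty\}$ is a function such that $\varphi(x) = 0$ iff $x \in M$. $Y^*$ is the topological dual, $\langle\cdot,\cdot\rangle$ is the duality pairing, $K^* = \{y^* \in Y^* : \langle y^*, y\rangle \ge 0 \ \forall y \in K\}$, and $K^*_+ = \{y^* \in K^* : \langle y^*, y \rangle > 0 \ \forall y \in K \setminus \{0\}\}$, assumed nonempty. $K^*_{++}$ is the set of all $\tau \in K^*_+$ for which there exists $c>0$ with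 $\langle \tau, y\rangle \ge c\|y\|$ for all $y \in K$. $\mathcal{T} \subset K^*_+$ is a fixed nonempty set with $\alpha\tau \in \mathcal{T}$ for all $\tau \in \mathcal{T}$, $\alpha>0$. For $\tau \in \mathcal{T}$, $\Phi_\tau(x) = f(x) + \langle \tau, \varphi(x)\rangle$, where $\langle \tau, \infty\rangle = +\infty$. Problem $(\mathcal{P}_\tau)$: minimize $\Phi_\tau(x)$ subject to $x \in Q$. Write $\tau \succeq_{K^*} \tau_*$ iff $\tau - \tau_* \in K^*$. Local exactness. If $x_*$ is a locally optimal solution of $(\mathcal{P})$, $\Phi_\tau$ is locally exact at $x_*$ if there is $\tau_* \in \mathcal{T}$ such that for all $\tau \in \mathcal{T}$ with $\tau \succeq_{K^*} \tau_*$ the point $x_*$ is a locally optimal solution of $(\mathcal{P}_\tau)$. A limit point of a sequence is the limit of some convergent subsequence. Simplest Global Exact Penalty Method. Choose $\tau_1 \in \mathcal{T}$ and $\theta > 1$; set $n := 1$. Main step: let $x_n$ be a globally optimal solution of $(\mathcal{P}_{\tau_n})$. If $n \ge 2$ and $\Phi_{\tau_n}(x_n) = \Phi_{\tau_{n-1}}(x_{n-1})$, stop. Otherwise put $\tau_{n+1} = \theta \tau_n$, $n := n+1$, and repeat the main step. *)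

(* Defs.v *)
From HB Require Import structures.
From mathcomp Require Import all_boot all_order all_algebra.
From mathcomp Require Import all_classical all_reals all_analysis.

Set Implicit Arguments.
Unset Strict Implicit.
Unset Printing Implicit Defensive.

Import Order.TTheory GRing.Theory Num.Theory.
Import numFieldNormedType.Exports.

Local Open Scope classical_set_scope.
Local Open Scope ring_scope.

Section cones.
Context {R : realType} {Y : normedModType R}.
Implicit Types (K : set Y) (t : Y -> R^o).

Definition cone K := forall (a : R) y, 0 < a -> K y -> K (a *: y).

(* In particular 0 \in K. *)
Definition pointed K := K `&` (-%R @` K) = [set 0].

(* The codomain is R^o so that functionals inherit the pointwise vector space
   structure on functions used in `t - s` and `a *: t`. *)
Definition topological_dual : set (Y -> R^o) :=
  [set t | linear t /\ continuous t].

Definition dual_cone K : set (Y -> R^o) :=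
  [set t | topological_dual t /\ forall y, K y -> 0 <= t y].

Definition dual_cone_pos K : set (Y -> R^o) :=
  [set t | dual_cone K t /\ forall y, K y -> y != 0 -> 0 < t y].

Definition dual_cone_coercive K : set (Y -> R^o) :=
  [set t | dual_cone_pos K t /\
    exists2 c : R, 0 < c & forall y, K y -> c * `|y| <= t y].

Definition dual_le K t s := dual_cone K (s - t).

(* The improper element of Y is None : option Y. *)
Definition improper_norm (y : option Y) : \bar R :=
  if y is Some y' then `|y'|%:E else +oo%E.

Definition improper_pairing t (y : option Y) : \bar R :=
  if y is Some y' then (t y' : R)%:E else +oo%E.

End cones.

Section optimization.
Context {R : realType} {X : metricType R}.
Implicit Types (g : X -> \bar R) (S : set X) (u : nat -> X).

Definition globally_optimal g S x := S x /\ forall y, S y -> (g x <= g y)%E.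

Definition locally_optimal g S x :=
  S x /\ \forall y \near x, S y -> (g x <= g y)%E.

(* Neighbourhoods are relative to S: those of x in `subspace S` are
   `within S (nbhs x)` when S x, and trivial otherwise. *)
Definition lower_semicontinuous_on S g :=
  @lower_semicontinuous (subspace S) R g.

Definition subsequential_limit u (a : X) :=
  exists2 s : nat -> nat, increasing_seq s & u \o s @ \oo --> a.

End optimization.

Section penalty.
Context {R : realType} {X : metricType R} {Y : normedModType R}.
Variables (Q : set X) (f : X -> \bar R) (phi : X -> option Y).
Implicit Types (t : Y -> R^o).

Definition penalty t x : \bar R := (f x + improper_pairing t (phi x))%E.

(* Meant for points x that are locally optimal for the constrained problem. *)
Definition locally_exact (K : set Y) (T : set (Y -> R^o)) x :=
  exists2 ts, T ts &
    forall t, T t -> dual_le K ts t -> locally_optimal (penalty t) Q x.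

Section method.
Variables (t1 : Y -> R^o) (theta : R).

(* Iterations are numbered from 0. *)
Fixpoint parameter n : Y -> R^o :=
  if n is m.+1 then theta *: parameter m else t1.

(* An execution is encoded as a sequence x : nat -> option X, where x n = None
   means that iteration n produces no point, either because it is never reached
   or because the penalized problem it has to solve has no optimal solution. *)
Implicit Type x : nat -> option X.

Definition stops_at x n :=
  exists m y z, [/\ n = m.+1, x m = Some y, x n = Some z &
    penalty (parameter n) z = penalty (parameter m) y].

Definition reached x n :=
  if n is m.+1 then x m <> None /\ ~ stops_at x m else True.

Definition solvable n :=
  exists y, globally_optimal (penalty (parameter n)) Q y.

(* The choice among several optimal solutions is arbitrary. *)
Definition execution x := forall n,
  [/\ reached x n -> solvable n ->
        exists2 y, x n = Some y & globally_optimal (penalty (parameter n)) Q y,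
      reached x n -> ~ solvable n -> x n = None
    & ~ reached x n -> x n = None].

End method.
End penalty.

(* Main.v *)
From HB Require Import structures.
Require Import Defs.
From mathcomp Require Import all_boot all_order all_algebra.
From mathcomp Require Import all_classical all_reals all_analysis.

Set Implicit Arguments.
Unset Strict Implicit.
Unset Printing Implicit Defensive.

Import Order.TTheory GRing.Theory Num.Theory.
Import numFieldNormedType.Exports.

Local Open Scope classical_set_scope.
Local Open Scope ring_scope.

(** Write f* for the optimal value of the constrained problem, t_n = theta^n t1
    for the n-th parameter, x_n for the n-th iterate and v_n for the minimal
    value of the n-th penalized problem. A feasible point pays no penalty, so
    v_n <= f*; and t_n increases in the order of the dual cone, so v_n is
    nondecreasing.

    If the method stops, that is v_{n+1} = v_n, then x_{n+1} would be strictly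
    cheaper for t_n than for theta t_n unless its penalty vanished; since v_n is
    already a minimum, the penalty is zero. Hence x_{n+1} is feasible, its cost
    is v_{n+1} <= f*, and it is optimal ([equal_minima_optimal]).

    If the method never stops, suppose that a subsequence of x_n converges to b.
    Because f is lower semicontinuous and never -oo, it is bounded below along
    the subsequence; then v_n <= f* forces theta^n t1(phi(x_n)) to stay bounded,
    and coercivity of t1 turns this into convergence of phi(x_n) to 0 in norm.
    Lower semicontinuity of both functions makes b feasible with f b <= f*, that
    is, b is globally optimal ([penalty_limit_optimal]). Now local exactness
    applies at b. Its threshold ts is a bounded functional, hence is dominated by
    t_N for N large, again by coercivity of t1 ([dual_le_scale_coercive]). So b
    minimizes the penalty function of t_N locally, and for a late enough term
    x_n of the subsequence, with n >= N,
      f* = f b <= (value at x_n for t_N) <= (value at x_n for t_n) = v_n <= f*.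
    By monotonicity v_n = v_{n+1} = f*, which is precisely the stopping test at
    step n+1: a contradiction. *)

(** * Geometric growth and subsequences *)

Lemma near_le_expr {R : realType} (q A : R) :
  1 < q -> \forall n \near \oo, A <= q ^+ n.
Proof.
move=> q1; have q0 : 0 < q by exact: lt_trans q1.
have B0 : 0 < `|A| + 1 by rewrite ltr_wpDl.
have q'1 : `|q^-1| < 1 by rewrite ger0_norm ?invr_ge0 ?ltW // invf_lt1.
have /cvgr0Pnorm_lt/(_ (`|A| + 1)^-1) := cvg_expr q'1.
rewrite invr_gt0 => /(_ B0); apply: filterS => n.
have qn0 : 0 < q ^+ n by rewrite exprn_gt0.
rewrite /= exprVn normfV (gtr0_norm qn0) ltf_pV2 ?posrE//.
by move=> /ltW; apply: le_trans; rewrite (le_trans (ler_norm A))// lerDl.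
Qed.

Lemma increasing_seq_cvgy (s : nat -> nat) : increasing_seq s -> s @ \oo --> \oo.
Proof.
move=> s_incr.
have s_ge n : (n <= s n)%N.
  elim: n => // n IHn; apply: leq_ltn_trans IHn _.
  by rewrite ltnNge; have := s_incr n.+1 n; rewrite !leEnat ltnn => ->.
move=> A [N _ NA]; exists N => // n /= Nn; apply: NA => /=.
exact: leq_trans (s_ge n).
Qed.

(** * Lower semicontinuity and optimal values *)

Section lower_semicontinuity.
Context {R : realType} {X : metricType R}.

Lemma lsc_on_near_lt (S : set X) (g : X -> \bar R) (u : nat -> X) a (r : R) :
  lower_semicontinuous_on S g -> (forall n, S (u n)) -> S a ->
  u @ \oo --> a -> (r%:E < g a)%E -> \forall n \near \oo, (r%:E < g (u n))%E.
Proof.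
move=> g_lsc Su Sa ua /g_lsc[V aV Vg].
have {aV} : within S (nbhs a) V by rewrite nbhs_subspace_in.
move=> /ua SV.
have {}SV : \forall n \near \oo, S (u n) -> V (u n) by exact: SV.
by apply: filterS SV => n SV; exact: Vg (SV (Su n)).
Qed.

(** The slack [e] lets the same statement serve for a constant upper bound and
    for upper bounds that tend to [r]. *)
Lemma lsc_on_limit_le (S : set X) (g : X -> \bar R) (u : nat -> X) a (r : R) :
  lower_semicontinuous_on S g -> (forall n, S (u n)) -> S a ->
  u @ \oo --> a ->
  (forall e, 0 < e -> \forall n \near \oo, (g (u n) <= (r + e)%:E)%E) ->
  (g a <= r%:E)%E.
Proof.
move=> g_lsc Su Sa ua g_le; apply/lee_addgt0Pr => e e0.
rewrite leNgt; apply/negP => /(lsc_on_near_lt g_lsc Su Sa ua) g_gt.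
have [n [un_le]] := filter_ex (filterI (g_le e e0) g_gt).
by rewrite ltNge un_le.
Qed.

Lemma globally_optimal_value (g : X -> \bar R) (S : set X) z :
  globally_optimal g S z -> g z = ereal_inf (g @` S).
Proof.
move=> [Sz z_min]; apply/eqP; rewrite eq_le; apply/andP; split.
  by apply/ereal_infP => _ [y Sy <-]; exact: z_min.
by apply: ereal_inf_lbound; exists z.
Qed.

End lower_semicontinuity.

(** * Growth of the penalty parameter in the dual order *)

Section dual_order.
Context {R : realType} {Y : normedModType R}.
Implicit Types (K : set Y) (s t : Y -> R^o).

Lemma topological_dualZ t (a : R) :
  topological_dual t -> topological_dual (a *: t).
Proof.
move=> [t_lin t_cont]; split.
  by move=> b y z; rewrite !fctE t_lin scalerDr !scalerA mulrC.
by move=> y; apply: cvgZr; exact: t_cont.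
Qed.

Lemma topological_dualB s t :
  topological_dual s -> topological_dual t -> topological_dual (s - t).
Proof.
move=> [s_lin s_cont] [t_lin t_cont]; split.
  by move=> b y z; rewrite !fctE s_lin t_lin scalerBr opprD addrACA.
by move=> y; apply: cvgB; [exact: s_cont|exact: t_cont].
Qed.

Lemma topological_dual0 t : topological_dual t -> t 0 = 0.
Proof.
move=> [t_lin _]; have := t_lin (-1) 0 0.
by rewrite scaler0 addr0 scaleN1r addNr.
Qed.

(** An upper bound on [t y] suffices for comparisons on a cone, so there is no
    absolute value on the left. *)
Lemma topological_dual_bounded t : topological_dual t ->
  exists C : R, forall y, t y <= C * `|y|.
Proof.
move=> [t_lin t_cont].
pose tL : {linear Y -> R^o} := HB.pack t (GRing.isLinear.Build _ _ _ _ t t_lin).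
have /linear_boundedP tL_bnd : bounded_near tL (nbhs 0).
  by apply: continuous_linear_bounded; exact: t_cont.
have [C _ t_le] := pinfty_ex_gt0 tL_bnd.
by exists C => y; exact: le_trans (ler_norm _) (t_le y).
Qed.

Lemma parameterE t (theta : R) n : parameter t theta n = theta ^+ n *: t.
Proof. by elim: n => [|n IHn] /=; rewrite ?scale1r// IHn scalerA exprS. Qed.

Lemma dual_leZ K t (a b : R) : dual_cone K t -> a <= b ->
  dual_le K (a *: t) (b *: t).
Proof.
move=> [t_dual t_ge0] ab; rewrite /dual_le -scalerBl; split.
  exact: topological_dualZ.
by move=> y /t_ge0 ty0; rewrite fctE mulr_ge0// subr_ge0.
Qed.

(** On the cone, [a n * t y >= a n * c * `|y|] by coercivity, while [s y] is at
    most a constant times [`|y|]. If [t] were only positive off the origin, its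
    infimum on the unit sphere of the cone could be 0 in infinite dimension, and
    then no multiple of [t] need dominate [s]. *)
Lemma dual_le_scale_coercive K s t (a : nat -> R) :
  topological_dual s -> dual_cone_coercive K t ->
  (forall A, \forall n \near \oo, A <= a n) ->
  \forall n \near \oo, dual_le K s (a n *: t).
Proof.
move=> s_dual [[[t_dual _] _] [c c0 t_ge]] a_infty.
have [C s_le] := topological_dual_bounded s_dual.
apply: filterS (a_infty (`|C| / c)) => n; rewrite ler_pdivrMr// => Ca.
split; first by apply: topological_dualB => //; exact: topological_dualZ.
move=> y Ky; rewrite !fctE subr_ge0 (le_trans (s_le y))//.
have a0 : 0 <= a n by rewrite -(pmulr_lge0 _ c0) (le_trans _ Ca).
rewrite (@le_trans _ _ (a n * c * `|y|))//.
  by rewrite ler_wpM2r// (le_trans (ler_norm C)).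
by rewrite -mulrA ler_wpM2l// t_ge.
Qed.

End dual_order.

(** * Penalty functions *)

Section penalty_function.
Context {R : realType} {X : metricType R} {Y : normedModType R}.
Context (M Q : set X) (f : X -> \bar R) (K : set Y) (phi : X -> option Y).
Implicit Types (s t : Y -> R^o) (z : X).

Lemma pairing_ge0 t z : dual_cone K t -> (forall y, phi z = Some y -> K y) ->
  (0 <= improper_pairing t (phi z))%E.
Proof.
move=> [_ t_ge0]; case: (phi z) => [y|] Ky; last exact: leey.
by rewrite lee_fin; exact: t_ge0 (Ky y erefl).
Qed.

Lemma penalty_feasible t z : topological_dual t -> phi z = Some 0 ->
  penalty f phi t z = f z.
Proof.
by move=> /topological_dual0 t0 phi0; rewrite /penalty phi0 /= t0 adde0.
Qed.

Lemma penalty_mono s t z : (forall y, phi z = Some y -> K y) ->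
  dual_le K s t -> (penalty f phi s z <= penalty f phi t z)%E.
Proof.
rewrite /penalty => Kphi [_ ts_ge0]; apply: leeD2l.
case: (phi z) Kphi => [y|] Ky; last exact: leey.
by rewrite lee_fin -subr_ge0; exact: ts_ge0 (Ky y erefl).
Qed.

Lemma penalty_minimum_le t z w : topological_dual t ->
  (forall v, phi v = Some 0 <-> M v) -> (M `&` Q) w ->
  globally_optimal (penalty f phi t) Q z ->
  (penalty f phi t z <= f w)%E.
Proof.
move=> t_dual phi_M [Mw Qw] [_ /(_ w Qw)].
by rewrite (penalty_feasible (z := w) t_dual)//; exact/phi_M.
Qed.

(** With p the pairing of [t] with [phi z], the chain
    [f z + theta * p = penalty t y <= f z + p] gives [(theta - 1) * p <= 0]; this is
    where finiteness of the values matters, as [f z] has to be cancelled. Strict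
    positivity of [t] then yields [phi z = 0]. *)
Lemma equal_minima_optimal t (theta : R) y z :
  f z != -oo%E -> (forall w, phi w = Some 0 <-> M w) ->
  (forall v, phi z = Some v -> K v) -> dual_cone_pos K t -> 1 < theta ->
  (exists2 w, (M `&` Q) w & (f w < +oo)%E) ->
  globally_optimal (penalty f phi t) Q y ->
  globally_optimal (penalty f phi (theta *: t)) Q z ->
  penalty f phi (theta *: t) z = penalty f phi t y ->
  globally_optimal f (M `&` Q) z.
Proof.
move=> fzN phi_M phiK [[t_dual _] t_gt0] theta1 [w MQw fw] y_opt z_opt eq_pen.
have tt_dual := topological_dualZ theta t_dual.
have z_le v : (M `&` Q) v -> (penalty f phi (theta *: t) z <= f v)%E.
  by move=> MQv; exact: penalty_minimum_le z_opt.
have zy : (penalty f phi (theta *: t) z <= penalty f phi t z)%E.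
  by rewrite eq_pen; apply: y_opt.2; exact: z_opt.1.
have phiz : phi z = Some 0.
  (* The common value is below f w, which excludes infinite terms. *)
  have := le_lt_trans (z_le w MQw) fw; move: zy; rewrite /penalty.
  case: (phi z) phiK => [v|] Kv /=; last by rewrite addey.
  case: (f z) fzN => // r _; rewrite -!EFinD !lee_fin lerD2l => tv_le _.
  have {Kv} Kv : K v by exact: Kv.
  congr Some; apply/eqP; apply: contraT => /(t_gt0 _ Kv) tv0.
  by move: tv_le; rewrite fctE leNgt ltr_pMl// theta1.
split=> [|v MQv]; first by split; [exact/phi_M|exact: z_opt.1].
by have := z_le v MQv; rewrite penalty_feasible.
Qed.

(** Bounded penalized values under an unbounded parameter force the penalties to
    vanish in the limit, since [f] cannot tend to [-oo] along a convergent
    sequence. The coercivity of [t] converts small pairings into small norms,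
    the only quantity that is assumed semicontinuous. *)
Lemma penalty_limit_optimal t (a : nat -> R) (v : nat -> X) b w :
  closed Q -> (forall z, f z != -oo%E) ->
  lower_semicontinuous_on Q f ->
  lower_semicontinuous_on Q (fun z => improper_norm (phi z)) ->
  (forall z, phi z = Some 0 <-> M z) ->
  (forall z y, phi z = Some y -> K y) ->
  dual_cone_coercive K t -> (forall A, \forall n \near \oo, A <= a n) ->
  globally_optimal f (M `&` Q) w -> f w \is a fin_num ->
  (forall n, Q (v n)) -> (forall n, penalty f phi (a n *: t) (v n) <= f w)%E ->
  v @ \oo --> b ->
  globally_optimal f (M `&` Q) b.
Proof.
move=> Q_closed fN f_lsc phi_lsc phi_M phiK t_coer a_infty w_opt fw Qv v_le vb.
have Qb : Q b by apply: (closed_cvg _ Q_closed _ _ vb); exact: nearW.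
have fb_le : (f b <= f w)%E.
  move: fw v_le => /fineK <- v_le.
  apply: (lsc_on_limit_le f_lsc Qv Qb vb) => e e0.
  apply: filterS (a_infty 0) => n an.
  apply: (@le_trans _ _ (fine (f w))%:E); last by rewrite lee_fin lerDl ltW.
  apply: le_trans (v_le n); rewrite leeDl//; apply: pairing_ge0 (phiK _).
  split; first by apply: topological_dualZ; exact: t_coer.1.1.1.
  by move=> y Ky; rewrite fctE mulr_ge0//; exact: t_coer.1.1.2.
suff Mb : M b by split=> // z MQz; exact: le_trans fb_le (w_opt.2 z MQz).
(* A lower bound l for f along the sequence leaves at most f w - l for the
   penalty terms. *)
have [l lb] : exists l : R, (l%:E < f b)%E.
  move: (fN b); case: (f b) => [r _| _|//]; last by exists 0; exact: ltry.
  by exists (r - 1); rewrite lte_fin gtrBl.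
have f_gt := lsc_on_near_lt f_lsc Qv Qb vb lb.
have [_ [c c0 t_ge]] := t_coer.
have : (improper_norm (phi b) <= 0%:E)%E.
  apply: (lsc_on_limit_le phi_lsc Qv Qb vb) => e e0; rewrite add0r.
  have ce0 : 0 < c * e by rewrite mulr_gt0.
  (* If the norm of phi (v n) exceeded e, then a n >= D / (c * e) would make the
     penalty term at least D, more than the available f w - l. *)
  have [D [D0 D_gt]] : exists D, 0 <= D /\ fine (f w) - l < D.
    by exists (`|fine (f w) - l| + 1); rewrite addr_ge0// ltr_pwDr// ler_norm.
  have {}a_infty := a_infty (D / (c * e)).
  apply: filterS2 f_gt a_infty => n + /[!ler_pdivrMr]// an.
  have := v_le n; rewrite -(fineK fw) /penalty.
  case: (f (v n)) (fN (v n)) => // [r _|_ /=]; last first.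
    by rewrite addye//; case: (phi _).
  case: (phi (v n)) (phiK (v n)) => [y /(_ y erefl) Ky|_]//=.
  rewrite -EFinD !lee_fin lte_fin fctE => rt_le lr.
  have aty : a n * (c * `|y|) <= fine (f w) - l.
    apply: (@le_trans _ _ (a n * t y)).
      by rewrite ler_wpM2l ?t_ge// -(pmulr_lge0 _ ce0) (le_trans D0).
    by rewrite lerBrDr (le_trans _ rt_le)// addrC lerD2r ltW.
  rewrite leNgt; apply/negP => ey; move: D_gt; apply/negP; rewrite -leNgt.
  apply: le_trans aty; apply: (le_trans an).
  rewrite ler_wpM2l//; last by rewrite ler_wpM2l// ltW.
  by rewrite -(pmulr_lge0 _ ce0) (le_trans D0).
move: (phi_M b) => [+ _]; case: (phi b) => [y|] //= phib0.
by rewrite lee_fin normr_le0 => /eqP y0; apply: phib0; rewrite y0.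
Qed.

End penalty_function.

(** * Executions of the method *)

Section method.
Context {R : realType} {X : metricType R} {Y : normedModType R}.
Context (Q : set X) (f : X -> \bar R) (phi : X -> option Y).
Context (t1 : Y -> R^o) (theta : R) (x : nat -> option X).
Context (x_execution : execution Q f phi t1 theta x).
Context (x_solvable : forall n, reached f phi t1 theta x n ->
  solvable Q f phi t1 theta n).

Lemma execution_optimal n z : x n = Some z ->
  globally_optimal (penalty f phi (parameter t1 theta n)) Q z.
Proof.
have [x_opt _ x_none] := x_execution n => xnz.
have n_reached : reached f phi t1 theta x n.
  by apply: contrapT => /x_none; rewrite xnz.
by have [y] := x_opt n_reached (x_solvable n_reached); rewrite xnz => -[->].
Qed.

Lemma execution_infinite : (forall n, ~ stops_at f phi t1 theta x n) ->
  exists u : nat -> X, forall n, x n = Some (u n).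
Proof.
move=> never_stops.
suff /choice[u xu] : forall n, exists y, x n = Some y by exists u.
have some_of_reached n : reached f phi t1 theta x n -> exists y, x n = Some y.
  move=> n_reached; have [+ _ _] := x_execution n.
  by move=> /(_ n_reached (x_solvable n_reached))[y ->]; exists y.
elim=> [|n [y xny]]; first exact: some_of_reached.
by apply: some_of_reached; split; [rewrite xny|exact: never_stops].
Qed.

(** Compare the values at the later minimizer [u n]: it is admissible for the
    earlier problem and pays more under the larger parameter. *)
Lemma execution_value_mono (K : set Y) (u : nat -> X) :
  dual_cone K t1 -> 1 <= theta -> (forall z y, phi z = Some y -> K y) ->
  (forall n, x n = Some (u n)) ->
  {homo (fun n => penalty f phi (parameter t1 theta n) (u n)) :
    m n / (m <= n)%N >-> (m <= n)%E}.
Proof.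
move=> t1_dual theta1 phiK xu m n mn.
have um_opt := execution_optimal (xu m); have un_opt := execution_optimal (xu n).
apply: le_trans (um_opt.2 (u n) un_opt.1) _.
apply: penalty_mono (phiK _) _; rewrite !parameterE.
by apply: dual_leZ => //; rewrite ler_weXn2l.
Qed.

End method.

Theorem theorem2 (R : realType) (X : metricType R) (Y : normedModType R)
    (M Q : set X) (f : X -> \bar R) (K : set Y) (phi : X -> option Y)
    (T : set (Y -> R^o)) (t1 : Y -> R^o) (theta : R) (x : nat -> option X)
    (MQ_nonempty : M `&` Q !=set0)
    (f_proper : forall z, f z != -oo%E)
    (P_has_solution : exists z, globally_optimal f (M `&` Q) z)
    (P_value_finite : ereal_inf (f @` (M `&` Q)) \is a fin_num)
    (K_closed : closed K)
    (K_convex : convex_set (K : set (convex_lmodType Y)))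
    (K_cone : cone K)
    (K_pointed : pointed K)
    (phi_K : forall z y, phi z = Some y -> K y)
    (phi_M : forall z, phi z = Some 0 <-> M z)
    (dual_pos_nonempty : dual_cone_pos K !=set0)
    (T_pos : T `<=` dual_cone_pos K)
    (T_nonempty : T !=set0)
    (T_scale : forall t (a : R), T t -> 0 < a -> T (a *: t))
    (Q_closed : closed Q)
    (f_lsc : lower_semicontinuous_on Q f)
    (phi_lsc : lower_semicontinuous_on Q (fun z => improper_norm (phi z)))
    (T_t1 : T t1)
    (t1_coercive : dual_cone_coercive K t1)
    (exactness : forall z, globally_optimal f (M `&` Q) z ->
      locally_exact Q f phi K T z)
    (theta_gt1 : 1 < theta)
    (x_execution : execution Q f phi t1 theta x)
    (x_solvable : forall n, reached f phi t1 theta x n ->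
      solvable Q f phi t1 theta n) :
  (exists n z, [/\ x n = Some z, stops_at f phi t1 theta x n
                 & globally_optimal f (M `&` Q) z])
  \/ (exists2 u : nat -> X, (forall n, x n = Some (u n))
                 & forall a, ~ subsequential_limit u a).
Proof.
have [w w_opt] := P_has_solution.
have fw : f w \is a fin_num by rewrite (globally_optimal_value w_opt).
have t1_dual : topological_dual t1 := t1_coercive.1.1.1.
have x_opt := execution_optimal x_execution x_solvable.
have T_param n : T (parameter t1 theta n).
  by rewrite parameterE; apply: T_scale => //; rewrite exprn_gt0// (lt_trans ltr01).
have param_dual n : topological_dual (parameter t1 theta n).
  by have [[]] := T_pos _ (T_param n).
have theta_infty (s : nat -> nat) : increasing_seq s ->
    forall A, \forall k \near \oo, A <= theta ^+ s k.
  by move=> /increasing_seq_cvgy s_oo A; exact: s_oo (near_le_expr A theta_gt1).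
have [[n x_stops]|never_stops] := pselect (exists n, stops_at f phi t1 theta x n).
  left; have [m [y [z [nE xm xn eq_pen]]]] := x_stops.
  rewrite nE in x_stops xn eq_pen *; exists m.+1, z; split=> //.
  apply: (equal_minima_optimal (t := parameter t1 theta m) (theta := theta)
    (y := y) _ phi_M (phi_K z)) => //.
  - exact: T_pos.
  - by exists w; [exact: w_opt.1|rewrite ltey_eq fw].
  - exact: x_opt.
  - exact: x_opt xn.
right.
have [|u xu] := execution_infinite x_execution x_solvable.
  by move=> n stops; apply: never_stops; exists n.
exists u => // b [s s_incr sb].
pose value n := penalty f phi (parameter t1 theta n) (u n).
have u_opt n := x_opt n (u n) (xu n).
have value_le z n : globally_optimal f (M `&` Q) z -> (value n <= f z)%E.
  by move=> z_opt; exact: penalty_minimum_le (param_dual n) phi_M z_opt.1 (u_opt n).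
have b_opt : globally_optimal f (M `&` Q) b.
  apply: (penalty_limit_optimal (v := u \o s) Q_closed f_proper f_lsc phi_lsc phi_M
    phi_K t1_coercive (theta_infty s s_incr) w_opt fw) => // k /=.
    exact: (u_opt _).1.
  by rewrite -parameterE; exact: value_le.
have phib : phi b = Some 0 by apply/phi_M; exact: b_opt.1.1.
have [ts Tts b_loc] := exactness b b_opt.
have [N ts_le] : exists N, dual_le K ts (parameter t1 theta N).
  have : \forall n \near \oo, dual_le K ts (theta ^+ n *: t1).
    apply: dual_le_scale_coercive => //; first exact: (T_pos _ Tts).1.1.
    by move=> A; exact: near_le_expr.
  by move=> /filter_ex[N]; rewrite -parameterE; exists N.
have [_ b_min] := b_loc _ (T_param N) ts_le.
have sN : \forall k \near \oo, (N <= s k)%N.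
  exact: increasing_seq_cvgy s_incr _ (nbhs_infty_ge N).
(* One late term of the subsequence, close to b and of index at least N. *)
have [k [Nk bk]] := filter_ex (filterI sN (sb _ b_min)).
have theta_ge1 := ltW theta_gt1.
have t1_cone : dual_cone K t1 := t1_coercive.1.1.
have value_mono := execution_value_mono x_execution x_solvable t1_cone theta_ge1
  phi_K xu.
have fb_le : (f b <= value (s k))%E.
  rewrite -(penalty_feasible f (param_dual N) phib).
  apply: le_trans (bk (u_opt _).1) _.
  apply: penalty_mono (phi_K _) _.
  by rewrite !parameterE; apply: dual_leZ => //; rewrite ler_weXn2l.
(* The value f b is attained at step s k, hence also at the next one. *)
apply: never_stops; exists (s k).+1, (s k), (u (s k)), (u (s k).+1); split=> //.
apply/eqP; rewrite eq_le; apply/andP; split; last exact: value_mono.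
exact: le_trans (value_le b _ b_opt) fb_le.
Qed.
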